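(* Let $\ell\ge2$ and let $W_k(z)=\sum_{n\ge0}w_n^{(k)}z^n$, $1\le k\le\ell$, be non-zero power series with non-negative coefficients. Let $O(z)=\prod_{k=1}^\ell W_k(z)$, $o_n=[z^n]O(z)$, and let $\rho_o$ be the radius of convergence of $O(z)$. Suppose that there is a sequence $(r_n)_{n\ge0}$ satisfying the subexponentiality condition such that the limit $$\lim_{n\to\infty}\frac{w_n^{(k)}}{r_n}\in[0,\infty[$$ exists for each $1\le k\le\ell$, and is positive for at least one $1\le k\le\ell$. Then $(o_n)_{n\ge0}$ satisfies the subexponentiality condition and the limit $$p_k=\lim_{n\to\infty}\frac{w_n^{(k)}\,O(\rho_o)}{o_n\,W_k(\rho_o)}\in[0,1]$$ exists for all $1\le k\le\ell$. The constants satisfy $\sum_{k=1}^\ell p_k=1$. Let $I\in\{1,\dots,\ell\}$ be a random integer with $\mathbb P(I=k)=p_k$, and for each $1\le k\le\ell$ let $X^{(k)}$ be a random non-negative integer with $\mathbb E[z^{X^{(k)}}]=\frac{W_k(z\rho_o)}{W_k(\rho_o)}$, with $I,X^{(1)},\dots,X^{(\ell)}$ independent. Let $$\Lambda_n=\Big(X^{(1)},\dots,X^{(I-1)},\ n-\sum_{1\le k\le\ell,\,k\ne I}X^{(k)},\ X^{(I+1)},\dots,X^{(\ell)}\Big).$$ Then, for the random vector $(P_1,\dots,P_\ell)$ (depending on $n$) defined in the context, $$\lim_{n\to\infty}\sup_{A\subset\mathbb N_0^\ell}\left|\mathbb P\big((P_1,\dots,P_\ell)\in A\big)-\mathbb P(\Lambda_n\in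 A)\right|=0.$$
   Context: For $n\ge0$ with $o_n>0$, $(P_1,\dots,P_\ell)$ is the random vector of non-negative integers with probability generating function $\mathbb E[z_1^{P_1}\cdots z_\ell^{P_\ell}]=\frac{[z^n]\prod_{k=1}^\ell W_k(z_kz)}{o_n}$; that is, $\mathbb P((P_1,\dots,P_\ell)=(n_1,\dots,n_\ell))=\frac1{o_n}\prod_{k=1}^\ell w_{n_k}^{(k)}$ whenever $n_1+\dots+n_\ell=n$. A sequence $(r_n)_{n\ge0}$ of non-negative reals satisfies the subexponentiality condition if the power series $r(z)=\sum_{n\ge0}r_nz^n$ has radius of convergence $\rho_r\in\,]0,\infty[$ and, as $n\to\infty$, $\frac{r_n}{r_{n+1}}\to\rho_r$ and $\frac1{r_n}\sum_{i+j=n}r_ir_j\to2r(\rho_r)<\infty$. *)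

(* Defs.v *)
From HB Require Import structures.
From mathcomp Require Import all_boot all_order all_algebra.
From mathcomp Require Import all_classical all_reals all_analysis.

Set Implicit Arguments.
Unset Strict Implicit.
Unset Printing Implicit Defensive.

Import Order.TTheory GRing.Theory Num.Theory.
Import numFieldNormedType.Exports.

Local Open Scope classical_set_scope.
Local Open Scope ring_scope.

(* A formal power series is identified with its sequence of coefficients. *)

Definition fps_one (R : realType) : R^nat := fun n => (n == 0%N)%:R.

Definition fps_mul (R : realType) (a b : R^nat) : R^nat :=
  fun n => \sum_(i < n.+1) a i * b (n - i)%N.

Definition fps_prod (R : realType) (l : nat) (w : 'I_l -> R^nat) : R^nat :=
  \big[@fps_mul R/@fps_one R]_(k < l) w k.

(* Only meaningful when the series converges at [x]. *)
Definition fps_eval (R : realType) (a : R^nat) (x : R) : R :=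
  limn (pseries a x).

Definition cv_radius (R : realType) (a : R^nat) : \bar R :=
  ereal_sup [set x%:E | x in [set x : R | 0 <= x /\ cvgn (pseries a x)]].

(* Only meaningful when the radius of convergence is finite. *)
Definition rho (R : realType) (a : R^nat) : R := fine (cv_radius a).

(* Since x / 0 = 0, the positive limit of the ratios forces [a n] to be nonzero
   for all large [n], so no quotient below is degenerate in the limit. *)
Definition subexponential (R : realType) (a : R^nat) : Prop :=
  [/\ forall n, 0 <= a n,
      (0 < cv_radius a < +oo)%E,
      a n / a n.+1 @[n --> \oo] --> rho a,
      cvgn (pseries a (rho a)) &
      fps_mul a a n / a n @[n --> \oo] --> 2 * fps_eval a (rho a)].

(* The sigma-algebra generated by a map into a countable discrete space. *)
Definition discrete_sigma (T S : Type) (X : T -> S) : set (set T) :=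
  preimage_set_system [set: T] X [set: set S].

Definition mutually_independent (d : measure_display) (T : measurableType d)
    (R : realType) (P : probability T R) (J : finType)
    (F : J -> set (set T)) : Prop :=
  forall (S : {set J}) (E : J -> set T), (forall j, j \in S -> F j (E j)) ->
    P (\bigcap_(j in [set j | j \in S]) E j) = (\prod_(j in S) P (E j))%E.

(* Independence of I, X^(1), ..., X^(l); the index [None] stands for I. *)
Definition independent_family (d : measure_display) (T : measurableType d)
    (R : realType) (P : probability T R) (l : nat)
    (I : T -> 'I_l) (X : 'I_l -> T -> nat) : Prop :=
  mutually_independent P (fun j : option 'I_l =>
    if j is Some k then discrete_sigma (X k) else discrete_sigma I).

Definition pgf (d : measure_display) (T : measurableType d) (R : realType)
    (P : probability T R) (X : T -> nat) (z : R) : \bar R :=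
  ('E_P[fun t => (z ^+ X t)%R])%E.

(* Integer-valued: the component of index [I t] may be negative. *)
Definition Lambda (T : Type) (l : nat) (I : T -> 'I_l) (X : 'I_l -> T -> nat)
    (n : nat) (t : T) : 'I_l -> int :=
  fun k => if k == I t then n%:Z - \sum_(j < l | j != I t) (X j t)%:Z
           else (X k t)%:Z.

Definition to_intvec (l : nat) (m : 'I_l -> nat) : 'I_l -> int :=
  fun k => (m k)%:Z.

Definition sup_distance (d d' : measure_display)
    (T : measurableType d) (T' : measurableType d') (R : realType)
    (Q : probability T R) (P : probability T' R) (l : nat)
    (Y : T -> 'I_l -> nat) (Z : T' -> 'I_l -> int) : \bar R :=
  ereal_sup [set `|Q (Y @^-1` A) - P (Z @^-1` (@to_intvec l @` A))|%E
            | A in [set: set ('I_l -> nat)]].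

(* Main.v *)
Require Import Defs.
From HB Require Import structures.
From mathcomp Require Import all_boot all_order all_algebra.
From mathcomp Require Import all_classical all_reals all_analysis.
From mathcomp Require Import measurable_realfun ring lra zify.

(** The statement is an instance of the principle of a single big jump. Write
    [rho] for the radius of convergence of the series of coefficients [r].

    A convolution of two sequences comparable to a subexponential sequence [r]
    is asymptotically carried by the terms in which one of the two indices stays
    bounded; if [a ~ alpha * r] and [b ~ beta * r], then
    [a * b ~ (alpha * b(rho) + beta * a(rho)) * r] ([cvg_fps_mul_div]). By
    induction [o] is equivalent to a positive multiple of [r], the multiple being
    [O(rho)] times the sum [M] of the quotients [lam k / W_k(rho)]
    ([cvg_fps_prod_div]). Subexponentiality is stable under such an equivalence
    ([subexponential_cvg_div]), and the limits [p k] are the quotients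
    [lam k / W_k(rho)] divided by their sum [M].

    For the total variation statement, the generating function of [X k] first
    determines its law, [w k i * rho ^ i / W_k(rho)] ([probability_of_pgf]). Fix
    a bound [K], a position [k], and values [u j <= K] for the other coordinates.
    The vector of sum [n] with these coordinates has, under the law of
    [(P_1, ..., P_l)], the probability [w k (n - S) / o n] times the product of
    the [w j (u j)], where [S] is the sum of the [u j]. As [n] grows this tends to
    the probability that [I = k] and that [X j = u j] for [j != k], an event on
    which [Lambda] is that very vector. There are finitely many choices of
    [(k, u)], and as [K] grows the corresponding events exhaust the probability
    space of [Lambda]. Because both sides have total mass 1, convergence on a
    finite set of vectors that carries almost all the mass of the limit bounds
    the difference uniformly over all sets ([probability_dist_le]). *)

Set Implicit Arguments.
Unset Strict Implicit.
Unset Printing Implicit Defensive.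

Import Order.TTheory GRing.Theory Num.Theory.
Import numFieldNormedType.Exports.

Local Open Scope classical_set_scope.
Local Open Scope ring_scope.

(** * Evaluating products of power series *)
Lemma fps_mul_ge0 (R : realType) (a b : R^nat) :
  (forall n, 0 <= a n) -> (forall n, 0 <= b n) -> forall n, 0 <= fps_mul a b n.
Proof. by move=> a0 b0 n; apply: sumr_ge0 => i _; apply: mulr_ge0. Qed.

Lemma fps_mul_expr (R : realType) (a b : R^nat) (x : R) (n : nat) :
  fps_mul a b n * x ^+ n
  = fps_mul (fun i => a i * x ^+ i) (fun i => b i * x ^+ i) n.
Proof.
rewrite /fps_mul big_distrl /=; apply: eq_bigr => i _.
rewrite -[in x ^+ n](subnKC (ltn_ord i : (i <= n)%N)) exprD.
by rewrite mulrACA.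
Qed.

Lemma series_fps_mul (R : realType) (c d : R^nat) (N : nat) :
  series (fps_mul c d) N = \sum_(i < N) c i * series d (N - i)%N.
Proof.
elim: N => [|N IH]; first by rewrite /series/= big_geq// big_ord0.
rewrite seriesSr IH.
have -> : \sum_(i < N.+1) c i * series d (N.+1 - i)%N
    = \sum_(i < N.+1) (c i * series d (N - i)%N + c i * d (N - i)%N).
  apply: eq_bigr => i _; rewrite -mulrDr subSn; last exact: (ltn_ord i).
  by rewrite seriesSr.
rewrite big_split/=; congr (_ + _).
by rewrite big_ord_recr/= subnn {3}/series/= big_geq// mulr0 addr0.
Qed.

Lemma series_nondecreasing (R : realType) (c : R^nat) :
  (forall n, 0 <= c n) -> {homo series c : n m / (n <= m)%N >-> n <= m}.
Proof. by move=> c0; apply: nondecreasing_series => n _ _. Qed.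

Lemma series_le_lim (R : realType) (c : R^nat) (C : R) :
  (forall n, 0 <= c n) -> series c @ \oo --> C -> forall N, series c N <= C.
Proof.
move=> c0 cC N; rewrite -(cvg_lim (@Rhausdorff R) cC).
by apply: nondecreasing_cvgn_le; [exact: series_nondecreasing|exact: cvgP cC].
Qed.

(** Cauchy product of non-negative series. The partial sum of order [N] of the
    product runs over the triangle [i + j < N], which lies in the square of side
    [N] and contains the one of side [N / 2]; the triangle sums are thus caught
    between two sequences that both tend to [C * D]. *)
Lemma cvg_series_fps_mul (R : realType) (c d : R^nat) (C D : R) :
  (forall n, 0 <= c n) -> (forall n, 0 <= d n) ->
  series c @ \oo --> C -> series d @ \oo --> D ->
  series (fps_mul c d) @ \oo --> C * D.
Proof.
move=> c0 d0 cC dD.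
have sc0 N : 0 <= series c N by apply: sumr_ge0.
have sd0 N : 0 <= series d N by apply: sumr_ge0.
have ub N : series (fps_mul c d) N <= series c N * series d N.
  rewrite series_fps_mul [X in _ <= X * _]/series/= big_mkord mulr_suml.
  apply: ler_sum => i _; rewrite ler_wpM2l//.
  by apply: series_nondecreasing => //; rewrite leq_subr.
have lb N : series c N * series d N <= series (fps_mul c d) (N + N)%N.
  rewrite series_fps_mul [X in X * _ <= _]/series/= big_mkord mulr_suml.
  rewrite big_split_ord/= -[leLHS]addr0; apply: lerD; last first.
    by apply: sumr_ge0 => i _; rewrite mulr_ge0.
  apply: ler_sum => i _; rewrite ler_wpM2l//.
  apply: series_nondecreasing => //; have := ltn_ord i; lia.
have cd0 := fps_mul_ge0 c0 d0.
have cv : cvgn (series (fps_mul c d)).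
  apply: nondecreasing_is_cvgn; first exact: series_nondecreasing.
  exists (C * D) => _ [N _ <-]; apply: (le_trans (ub N)).
  by rewrite ler_pM// series_le_lim.
have cCD : (series c \* series d) n @[n --> \oo] --> C * D by exact: cvgM.
suff -> : C * D = limn (series (fps_mul c d)) by [].
apply/eqP; rewrite eq_le; apply/andP; split; last first.
  rewrite -(cvg_lim (@Rhausdorff R) cCD).
  by apply: ler_lim => //; [exact: cvgP cCD|near=> n; exact: ub].
rewrite -(cvg_lim (@Rhausdorff R) cCD).
apply: limr_le; first exact: cvgP cCD.
near=> n; apply: (le_trans (lb n)); apply: nondecreasing_cvgn_le => //.
exact: series_nondecreasing.
Unshelve. all: by end_near. Qed.

Lemma cvg_pseries_fps_mul (R : realType) (a b : R^nat) (x A B : R) :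
  0 <= x -> (forall n, 0 <= a n) -> (forall n, 0 <= b n) ->
  pseries a x @ \oo --> A -> pseries b x @ \oo --> B ->
  pseries (fps_mul a b) x @ \oo --> A * B.
Proof.
move=> x0 a0 b0 aA bB; rewrite /pseries.
have -> : [sequence fps_mul a b i * x ^+ i]_i
    = fps_mul (fun i => a i * x ^+ i) (fun i => b i * x ^+ i).
  by apply/funext => i; rewrite -fps_mul_expr.
by apply: cvg_series_fps_mul => // n; rewrite mulr_ge0// exprn_ge0.
Qed.

Lemma cvg_pseries_fps_one (R : realType) (x : R) :
  pseries (@fps_one R) x @ \oo --> (1 : R).
Proof.
rewrite -(cvg_shiftn 1) /=.
have E n : pseries (@fps_one R) x (n + 1)%N = 1.
  rewrite addn1 /pseries /series/= big_nat_recl//= /fps_one/= expr0 mulr1.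
  by rewrite big1 ?addr0// => i _; rewrite mul0r.
by under eq_fun do rewrite E; exact: cvg_cst.
Qed.

(** * Convolutions of subexponential sequences *)

(** A term of a convolution has a left factor of small index, a right factor of
    small index, or two factors of index at least [K]. For the first
    two kinds the ratio condition suffices; the convolution condition controls
    the last one. *)
Lemma fps_mul_split (R : realType) (a b : R^nat) (K n : nat) :
  (K + K <= n)%N ->
  fps_mul a b n = \sum_(i < K) a i * b (n - i)%N + \sum_(i < K) a (n - i)%N * b i
    + \sum_(K <= i < n.+1 - K) a i * b (n - i)%N.
Proof.
move=> Kn; rewrite /fps_mul -(big_mkord xpredT (fun i => a i * b (n - i)%N)).
rewrite (big_cat_nat _ _ (n := K))//=; last by lia.
rewrite [X in _ + X](big_cat_nat _ _ (n := (n.+1 - K)%N))//=; [|lia|lia].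
rewrite big_mkord -addrA; congr (_ + _); rewrite addrC; congr (_ + _).
rewrite big_nat_rev/= -{1}[(n.+1 - K)%N]add0n big_addn.
have -> : (n.+1 - (n.+1 - K) = K)%N by lia.
rewrite big_mkord; apply: eq_bigr => i _.
by have iK := ltn_ord i; congr (a _ * b _); lia.
Qed.

(** Interchange of limits in the form needed twice below: for each cut-off
    [K], [x] is approximated by [U K] up to an error [V K], and the limit of
    the error in [n] vanishes as the cut-off grows. *)
Lemma cvg_double_limit (R : realType) (x s v : R^nat) (S : R)
  (U V : nat -> R^nat) :
  (forall K, U K @ \oo --> s K) -> (forall K, V K @ \oo --> v K) ->
  s @ \oo --> S -> v @ \oo --> (0 : R) ->
  (\forall K \near \oo, \forall n \near \oo, `|x n - U K n| <= V K n) ->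
  x @ \oo --> S.
Proof.
move=> Us Vv sS v0 [K0 _ xUV]; apply/cvgrPdist_le => e e0.
have e4 : 0 < e / 4 by lra.
have /cvgrPdist_le/(_ _ e4)[K1 _ H1] := sS.
have /cvgrPdist_le/(_ _ e4)[K2 _ H2] := v0.
pose K := (K0 + K1 + K2)%N.
have := H1 K; have := H2 K; have := xUV K; rewrite /K/=.
have -> : (K0 <= K0 + K1 + K2)%N by lia.
have -> : (K1 <= K0 + K1 + K2)%N by lia.
have -> : (K2 <= K0 + K1 + K2)%N by lia.
rewrite -/K => /(_ isT) H /(_ isT) h2 /(_ isT) h1.
near=> n.
have hx : `|x n - U K n| <= V K n by near: n.
have hu : `|s K - U K n| <= e / 4.
  by near: n; have /cvgrPdist_le := Us K; apply.
have hv : `|v K - V K n| <= e / 4.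
  by near: n; have /cvgrPdist_le := Vv K; apply.
move: hx hu hv h1 h2; rewrite !ler_norml; lra.
Unshelve. all: by end_near. Qed.

Lemma subexponential_near_gt0 (R : realType) (r : R^nat) :
  subexponential r -> \forall n \near \oo, 0 < r n.
Proof.
move=> [r0 /andP[cv0 cvoo] rr _ _].
have rho0 : 0 < rho r by rewrite /rho fine_gt0// cv0 cvoo.
near=> n.
have : 0 < r n / r n.+1 by near: n; exact: (cvgr_gt _ rr).
by move=> h; rewrite lt_def r0 andbT; apply: contraTneq h => ->; rewrite mul0r ltxx.
Unshelve. all: by end_near. Qed.

Lemma subexponential_rho_gt0 (R : realType) (r : R^nat) :
  subexponential r -> 0 < rho r.
Proof. by move=> [_ /andP[cv0 cvoo] _ _ _]; rewrite /rho fine_gt0// cv0 cvoo. Qed.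

(** Shifting the index by a fixed [i] costs a factor [rho r ^+ i], since each of
    the [i] ratios [r m / r m.+1] tends to [rho r]. *)
Lemma cvg_subn_div (R : realType) (r b : R^nat) (beta : R) (i : nat) :
  subexponential r -> b n / r n @[n --> \oo] --> beta ->
  b (n - i)%N / r n @[n --> \oo] --> beta * rho r ^+ i.
Proof.
move=> sr bb; rewrite -(cvg_shiftn i).
rewrite [[sequence _]_n](_ : _ = fun n => b n / r (n + i)%N); last first.
  by apply/funext => n /=; rewrite addnK.
elim: i => [|i IH]; first by under eq_fun do rewrite addn0; rewrite expr0 mulr1.
have r0 := subexponential_near_gt0 sr.
have [_ _ rr _ _] := sr.
have rri : r (n + i)%N / r (n + i).+1 @[n --> \oo] --> rho r.
  by rewrite (cvg_shiftn i (fun n => r n / r n.+1)).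
have r0i : \forall n \near \oo, 0 < r (n + i)%N.
  by have [N _ h] := r0; exists N => // n /= Nn; apply: h => /=; lia.
rewrite exprSr mulrA; apply: cvg_trans (cvgM IH rri); apply: near_eq_cvg.
near=> n; have p : 0 < r (n + i)%N by near: n.
by rewrite /= addnS mulrA divfK ?gt_eqF.
Unshelve. all: by end_near. Qed.

Lemma near_le_of_cvg_div (R : realType) (a r : R^nat) (alpha : R) :
  (\forall n \near \oo, 0 < r n) -> a n / r n @[n --> \oo] --> alpha ->
  \forall n \near \oo, a n <= (`|alpha| + 1) * r n.
Proof.
move=> r0 ar; near=> n.
have p : 0 < r n by near: n.
rewrite -ler_pdivrMr//; near: n; apply: (cvgr_le _ ar).
by have := ler_norm alpha; lra.
Unshelve. all: by end_near. Qed.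

Lemma near_gt0_of_cvg_div (R : realType) (a r : R^nat) (L : R) :
  (\forall n \near \oo, 0 < r n) -> 0 < L ->
  a n / r n @[n --> \oo] --> L -> \forall n \near \oo, 0 < a n.
Proof.
move=> rpos L0 ar; near=> n; have p : 0 < r n by near: n.
have : 0 < a n / r n by near: n; exact: (cvgr_gt _ ar).
by rewrite pmulr_lgt0// invr_gt0.
Unshelve. all: by end_near. Qed.

Lemma cvg_div_inv (R : realType) (a r : R^nat) (L : R) :
  0 < L -> a n / r n @[n --> \oo] --> L -> r n / a n @[n --> \oo] --> L^-1.
Proof.
move=> L0 ar.
have : (a n / r n)^-1 @[n --> \oo] --> L^-1 by apply: cvgV => //; rewrite gt_eqF.
by under eq_fun do rewrite invf_div.
Qed.
Lemma is_cvg_pseries_dominated (R : realType) (a r : R^nat) (x C : R) :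
  0 <= x -> 0 <= C -> (forall n, 0 <= a n) -> (forall n, 0 <= r n) ->
  (\forall n \near \oo, a n <= C * r n) ->
  cvgn (pseries r x) -> cvgn (pseries a x).
Proof.
move=> x0 C0 a0 r0 [N _ ar] cr.
rewrite /pseries -(is_cvg_series_restrict N).
have cCr : cvgn (series (fun i => C * (r i * x ^+ i))).
  rewrite (_ : series _ = fun n => C * pseries r x n).
    by apply: is_cvgM => //; exact: is_cvg_cst.
  by apply/funext => n; rewrite /pseries /series/= big_distrr.
have ge i : 0 <= a i * x ^+ i by rewrite mulr_ge0// exprn_ge0.
have geC i : 0 <= C * (r i * x ^+ i) by rewrite !mulr_ge0// exprn_ge0.
apply: nondecreasing_is_cvgn.
  move=> m n mn /=; case: (leqP N m) => Nm.
    by rewrite [leRHS](big_cat_nat (n := m))//= lerDl; apply: sumr_ge0.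
  by rewrite big_geq ?sumr_ge0// ltnW.
exists (limn (series (fun i => C * (r i * x ^+ i)))) => _ [n _ <-].
apply: (@le_trans _ _ (series (fun i => C * (r i * x ^+ i)) n)); last first.
  by apply: series_le_lim.
rewrite /series/=; case: (leqP N n) => Nn.
  2: by rewrite big_geq ?sumr_ge0// ltnW.
rewrite [leRHS](big_cat_nat (n := N))//= -[leLHS]add0r lerD ?sumr_ge0//.
rewrite 2!big_nat; apply: ler_sum => i /andP[Ni _].
by rewrite mulrA ler_wpM2r ?exprn_ge0// ar.
Qed.

Lemma is_cvg_pseries_of_cvg_div (R : realType) (a r : R^nat) (alpha : R) :
  subexponential r -> (forall n, 0 <= a n) ->
  a n / r n @[n --> \oo] --> alpha -> cvgn (pseries a (rho r)).
Proof.
move=> sr a0 ar; have [r0 _ _ cr _] := sr.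
apply: (is_cvg_pseries_dominated (C := `|alpha| + 1) _ _ a0 r0 _ cr).
- exact: ltW (subexponential_rho_gt0 sr).
- by have := normr_ge0 alpha; lra.
- by apply: near_le_of_cvg_div ar; exact: subexponential_near_gt0.
Qed.

(** One large factor dominates a convolution of two sequences comparable to a
    subexponential one. Cut the sum as in [fps_mul_split]. For fixed [K] the two
    outer parts, divided by [r n], converge to partial sums of the two terms of
    the limit. The middle part is at most [C ^+ 2] times the middle part of
    [fps_mul r r], and the latter, divided by [r n], tends to
    [2 * (fps_eval r (rho r) - pseries r (rho r) K)], because the condition on
    [fps_mul r r] gives its total and the outer parts are known. *)
Lemma cvg_fps_mul_div (R : realType) (r a b : R^nat) (alpha beta : R) :
  subexponential r -> (forall n, 0 <= a n) -> (forall n, 0 <= b n) ->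
  a n / r n @[n --> \oo] --> alpha -> b n / r n @[n --> \oo] --> beta ->
  fps_mul a b n / r n @[n --> \oo] -->
    alpha * fps_eval b (rho r) + beta * fps_eval a (rho r).
Proof.
move=> sr a0 b0 ar br; have [r0 _ _ cr rr] := sr.
have rpos := subexponential_near_gt0 sr.
have ca := is_cvg_pseries_of_cvg_div sr a0 ar.
have cb := is_cvg_pseries_of_cvg_div sr b0 br.
pose C : R := `|alpha| + `|beta| + 1.
have C0 : 0 <= C by rewrite /C addr_ge0.
(* The outer part of [fps_mul c d n / r n] in which [c] has the small index. *)
pose Z (c d : R^nat) K n := \sum_(i < K) c i * (d (n - i)%N / r n).
have ZE (c d : R^nat) (delta : R) K : d n / r n @[n --> \oo] --> delta ->
    Z c d K n @[n --> \oo] --> delta * pseries c (rho r) K.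
  move=> dr; rewrite /pseries /series/= big_mkord big_distrr/=.
  apply: cvg_big => [|i _]; first exact: add_continuous.
  rewrite mulrCA.
  by apply: cvgMl_tmp; exact: cvg_subn_div.
have r1 : r n / r n @[n --> \oo] --> (1 : R).
  apply: cvg_near_cst.
  by near=> n; rewrite /= divff// gt_eqF//; near: n.
apply: (@cvg_double_limit R _
  (fun K => beta * pseries a (rho r) K + alpha * pseries b (rho r) K)
  (fun K => C ^+ 2 * (2 * fps_eval r (rho r)
    - (1 * pseries r (rho r) K + 1 * pseries r (rho r) K))) _
  (fun K n => Z a b K n + Z b a K n)
  (fun K n => C ^+ 2 * (fps_mul r r n / r n - (Z r r K n + Z r r K n)))).
- by move=> K; apply: cvgD; exact: ZE.
- move=> K; apply: cvgMl_tmp; apply: cvgB => //.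
  by apply: cvgD; exact: ZE.
- by rewrite addrC; apply: cvgD; apply: cvgMl_tmp.
- rewrite [X in _ --> X](_ : 0 = C ^+ 2 * (2 * fps_eval r (rho r)
    - (1 * fps_eval r (rho r) + 1 * fps_eval r (rho r)))); last by ring.
  apply: cvgMl_tmp; apply: cvgB; first exact: cvg_cst.
  by apply: cvgD; apply: cvgMl_tmp.
- have leC : \forall n \near \oo, a n <= C * r n /\ b n <= C * r n.
    near=> n; have p : 0 < r n by near: n.
    split.
      apply: (@le_trans _ _ ((`|alpha| + 1) * r n)).
        by near: n; exact: near_le_of_cvg_div.
      by rewrite ler_pM2r// /C; have := normr_ge0 beta; lra.
    apply: (@le_trans _ _ ((`|beta| + 1) * r n)).
      by near: n; exact: near_le_of_cvg_div.
    by rewrite ler_pM2r// /C; have := normr_ge0 alpha; lra.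
  have [N _ {}leC] := leC; exists N => // K /= NK.
  near=> n; have p : 0 < r n by near: n.
  have KKn : (K + K <= n)%N by near: n; exact: nbhs_infty_ge.
  have E (c d : R^nat) : fps_mul c d n / r n - (Z c d K n + Z d c K n)
      = (\sum_(K <= i < n.+1 - K) c i * d (n - i)%N) / r n.
    rewrite (fps_mul_split _ _ KKn) 2!mulrDl addrAC.
    suff -> : (\sum_(i < K) c i * d (n - i)%N) / r n +
      (\sum_(i < K) c (n - i)%N * d i) / r n = Z c d K n + Z d c K n.
      by rewrite subrr add0r.
    rewrite /Z !big_distrl/=; congr (_ + _); apply: eq_bigr => i _.
      by rewrite mulrA.
    by rewrite [RHS]mulrCA mulrA.
  rewrite !E ger0_norm; last first.
    by apply: divr_ge0; [apply: sumr_ge0 => i _; exact: mulr_ge0|exact: ltW].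
  rewrite mulrA ler_pM2r ?invr_gt0// big_distrr/= 2!big_nat.
  apply: ler_sum => i /andP[Ki iK].
  have [ai _] := leC i (leq_trans NK Ki).
  have [_ bi] : a (n - i)%N <= C * r (n - i)%N /\ b (n - i)%N <= C * r (n - i)%N.
    by apply: leC; move: iK NK => /=; lia.
  by apply: le_trans (ler_pM _ _ ai bi) _ => //; rewrite expr2 mulrACA.
Unshelve. all: by end_near. Qed.

Lemma cv_radius_cvg_div (R : realType) (a r : R^nat) (L : R) :
  (forall n, 0 <= a n) -> (forall n, 0 <= r n) ->
  (\forall n \near \oo, 0 < r n) -> 0 < L ->
  a n / r n @[n --> \oo] --> L -> cv_radius a = cv_radius r.
Proof.
move=> a0 r0 rpos L0 ar; rewrite /cv_radius; congr (ereal_sup [set x%:E | x in _]).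
have apos := near_gt0_of_cvg_div rpos L0 ar.
have ra := cvg_div_inv L0 ar.
apply/seteqP; split => x [x0 cx]; split=> //.
  apply: (is_cvg_pseries_dominated (C := `|L^-1| + 1) x0 _ r0 a0 _ cx).
    by rewrite addr_ge0.
  exact: near_le_of_cvg_div.
apply: (is_cvg_pseries_dominated (C := `|L| + 1) x0 _ a0 r0 _ cx).
  by rewrite addr_ge0.
exact: near_le_of_cvg_div.
Unshelve. all: by end_near. Qed.

(** Subexponentiality only depends on the asymptotic class: domination both ways
    transfers the radius of convergence, and [cvg_fps_mul_div] applied to
    [fps_mul a a] transfers the convolution condition. *)
Lemma subexponential_cvg_div (R : realType) (a r : R^nat) (L : R) :
  subexponential r -> (forall n, 0 <= a n) -> 0 < L ->
  a n / r n @[n --> \oo] --> L -> subexponential a.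
Proof.
move=> sr a0 L0 ar; have [r0 cvr rr cr _] := sr.
have rpos := subexponential_near_gt0 sr.
have cva := cv_radius_cvg_div a0 r0 rpos L0 ar.
have rhoa : rho a = rho r by rewrite /rho cva.
have apos := near_gt0_of_cvg_div rpos L0 ar.
have ra := cvg_div_inv L0 ar.
split; rewrite ?cva ?rhoa//.
- have raS : r n.+1 / a n.+1 @[n --> \oo] --> L^-1.
    by rewrite (cvg_shiftS (fun n => r n / a n)).
  have rposS : \forall n \near \oo, 0 < r n.+1.
    by have [N _ h] := rpos; exists N => // n /= Nn; apply: h => /=; lia.
  have -> : rho r = L * rho r * L^-1 by rewrite mulrAC divff ?mul1r// gt_eqF.
  apply: cvg_trans (cvgM (cvgM ar rr) raS); apply: near_eq_cvg; near=> n.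
  have p : 0 < r n by near: n.
  have q : 0 < r n.+1 by near: n.
  by rewrite /= (mulrA (a n / r n)) divfK ?gt_eqF// mulrA divfK ?gt_eqF.
- exact: is_cvg_pseries_of_cvg_div ar.
- have E (e : R) : (L * e + L * e) * L^-1 = 2 * e by field; rewrite gt_eqF.
  rewrite -E -rhoa.
  have h := cvg_fps_mul_div sr a0 a0 ar ar; rewrite -rhoa in h.
  apply: cvg_trans (cvgM h ra); apply: near_eq_cvg; near=> n.
  have p : 0 < r n by near: n.
  by rewrite /= mulrA divfK ?gt_eqF.
Unshelve. all: by end_near. Qed.

(** * Asymptotics of a product of several power series *)
Lemma fps_eval_gt0 (R : realType) (a : R^nat) (x : R) :
  0 < x -> (forall n, 0 <= a n) -> (exists n, a n != 0) ->
  cvgn (pseries a x) -> 0 < fps_eval a x.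
Proof.
move=> x0 a0 [n an] ca.
have t0 i : 0 <= a i * x ^+ i by rewrite mulr_ge0// exprn_ge0// ltW.
apply: (@lt_le_trans _ _ (pseries a x n.+1)); last exact: series_le_lim.
rewrite /pseries seriesSr; apply: ltr_wpDl; first by rewrite /series/= sumr_ge0.
by rewrite /= mulr_gt0 ?exprn_gt0// lt_def an a0.
Qed.

Lemma fps_prod_seq_ge0 (R : realType) (J : Type) (s : seq J) (w : J -> R^nat) :
  (forall k n, 0 <= w k n) ->
  forall n, 0 <= (\big[@fps_mul R/@fps_one R]_(k <- s) w k) n.
Proof.
move=> w0; elim: s => [|k s IH] n; first by rewrite big_nil ler0n.
by rewrite big_cons; apply: fps_mul_ge0.
Qed.

Lemma cvg_pseries_fps_prod (R : realType) (J : Type) (s : seq J)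
  (w : J -> R^nat) (x : R) :
  0 <= x -> (forall k n, 0 <= w k n) -> (forall k, cvgn (pseries (w k) x)) ->
  pseries (\big[@fps_mul R/@fps_one R]_(k <- s) w k) x @ \oo -->
    \prod_(k <- s) fps_eval (w k) x.
Proof.
move=> x0 w0 cw; elim: s => [|k s IH].
  by rewrite !big_nil; exact: cvg_pseries_fps_one.
rewrite !big_cons; apply: cvg_pseries_fps_mul => //.
exact: fps_prod_seq_ge0.
Qed.

(** Iterating [cvg_fps_mul_div]: exactly one factor carries the large index, and
    each of the others contributes its total mass. Writing the limit with a
    quotient [lam k / fps_eval (w k) (rho r)], instead of a product over the
    indices different from [k], lets the induction run over any list of
    indices, repetitions included. *)
Lemma cvg_fps_prod_div (R : realType) (r : R^nat) (J : Type) (s : seq J)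
  (w : J -> R^nat) (lam : J -> R) :
  subexponential r -> (forall k n, 0 <= w k n) ->
  (forall k, exists n, w k n != 0) ->
  (forall k, w k n / r n @[n --> \oo] --> lam k) ->
  (\big[@fps_mul R/@fps_one R]_(k <- s) w k) n / r n @[n --> \oo] -->
    (\prod_(k <- s) fps_eval (w k) (rho r)) *
    (\sum_(k <- s) lam k / fps_eval (w k) (rho r)).
Proof.
move=> sr w0 wn0 wr.
have rho0 := subexponential_rho_gt0 sr.
have cw k : cvgn (pseries (w k) (rho r)) by exact: is_cvg_pseries_of_cvg_div (wr k).
elim: s => [|k s IH].
  rewrite !big_nil mulr0; apply: cvg_near_cst; near=> n.
  have n0 : (0 < n)%N by near: n; exact: nbhs_infty_gt.
  by rewrite /fps_one gtn_eqF// mul0r.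
rewrite !big_cons.
set Pi := \prod_(j <- s) _ in IH *; set Sg := \sum_(j <- s) _ in IH *.
set W := fps_eval (w k) _.
have W0 : W != 0 by rewrite gt_eqF// fps_eval_gt0.
have -> : W * Pi * (lam k / W + Sg) = lam k * Pi + Pi * Sg * W by field.
have EPi : fps_eval (\big[@fps_mul R/@fps_one R]_(j <- s) w j) (rho r) = Pi.
  by apply: cvg_lim => //; apply: cvg_pseries_fps_prod => //; exact: ltW.
have := cvg_fps_mul_div sr (w0 k) (fps_prod_seq_ge0 s w0) (wr k) IH.
by rewrite EPi.
Unshelve. all: by end_near. Qed.

(** * Recovering a law from its generating function *)
Lemma pseries_head_le (R : realType) (a : R^nat) (z s : R) (N : nat) :
  0 <= z -> (forall n, 0 <= a n) -> pseries a z @ \oo --> s ->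
  pseries a z N <= s.
Proof.
by move=> z0 a0 az; apply: series_le_lim => // n; rewrite mulr_ge0 ?exprn_ge0.
Qed.

Lemma pseries_tail_le (R : realType) (a : R^nat) (z s A : R) (N : nat) :
  0 <= z <= 1 -> (forall n, 0 <= a n) -> (forall n, series a n <= A) ->
  pseries a z @ \oo --> s -> s <= pseries a z N + A * z ^+ N.
Proof.
move=> /andP[z0 z1] a0 aA az; rewrite -(cvg_lim (@Rhausdorff R) az).
apply: limr_le; first exact: cvgP az.
near=> n; have Nn : (N <= n)%N by near: n; exact: nbhs_infty_ge.
rewrite /pseries /series/= [leLHS](big_cat_nat (n := N))//= lerD2l.
apply: (@le_trans _ _ (\sum_(N <= i < n) a i * z ^+ N)).
  rewrite 2!big_nat; apply: ler_sum => i /andP[Ni _].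
  by rewrite ler_wpM2l// ler_wiXn2l.
rewrite -big_distrl/= ler_wpM2r ?exprn_ge0//; apply: le_trans (aA n).
by rewrite /series/= [leRHS](big_cat_nat (n := N))//= lerDr sumr_ge0.
Unshelve. all: by end_near. Qed.

(** If the coefficients below [N] agree, the tail bounds leave a difference of at
    most [C * z ^+ N.+1] for the terms of order [N], so that
    [`|a N - b N| <= C * z] for every small positive [z]. *)
Lemma pseries_coef_unique (R : realType) (a b : R^nat) (sz : R -> R) :
  (forall n, 0 <= a n) -> (forall n, 0 <= b n) ->
  cvgn (series a) -> cvgn (series b) ->
  (forall z, 0 <= z <= 1 -> pseries a z @ \oo --> sz z) ->
  (forall z, 0 <= z <= 1 -> pseries b z @ \oo --> sz z) ->
  forall n, a n = b n.
Proof.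
move=> a0 b0 ca cb az bz.
pose C : R := limn (series a) + limn (series b).
have aC n : series a n <= limn (series a) by exact: series_le_lim.
have bC n : series b n <= limn (series b) by exact: series_le_lim.
have A0 : 0 <= limn (series a) by apply: le_trans (aC 0%N); rewrite sumr_ge0.
have B0 : 0 <= limn (series b) by apply: le_trans (bC 0%N); rewrite sumr_ge0.
elim/ltn_ind => N IH.
have eqN z : pseries a z N = pseries b z N.
  by rewrite /pseries/series/= 2!big_nat; apply: eq_bigr => i /andP[_ /IH ->].
have bound z : 0 < z -> z <= 1 -> `|a N - b N| <= C * z.
  move=> z0 z1; have z01 : 0 <= z <= 1 by rewrite ltW.
  have ha1 := pseries_head_le N.+1 (ltW z0) a0 (az z z01).
  have hb1 := pseries_head_le N.+1 (ltW z0) b0 (bz z z01).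
  have ha2 := pseries_tail_le N.+1 z01 a0 aC (az z z01).
  have hb2 := pseries_tail_le N.+1 z01 b0 bC (bz z z01).
  have zN : 0 < z ^+ N by rewrite exprn_gt0.
  rewrite -(ler_pM2r zN) -mulrA -exprS -[z ^+ N in leLHS]gtr0_norm// -normrM.
  move: ha1 hb1 ha2 hb2; rewrite /pseries !seriesSr.
  rewrite -/(pseries a z) -/(pseries b z) eqN /=.
  have zN1 : 0 < z ^+ N.+1 by rewrite exprn_gt0.
  have := mulr_ge0 A0 (ltW zN1); have := mulr_ge0 B0 (ltW zN1).
  rewrite mulrBl ler_norml /C mulrDl; lra.
apply/eqP; rewrite -subr_eq0 -normr_le0; apply/ler_addgt0Pr => e e0; rewrite add0r.
have C0 : 0 <= C by rewrite addr_ge0.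
(* The value [z = e / (C + 1 + e)] satisfies both [z <= 1] and [C * z <= e]. *)
have C1 : 0 < C + 1 + e by lra.
apply: (le_trans (bound (e / (C + 1 + e)) _ _)).
- by rewrite divr_gt0.
- by rewrite ler_pdivrMr// mul1r; lra.
- rewrite mulrCA ger_pMr// ler_pdivrMr// mul1r; lra.
Qed.

Lemma cvg_pseries_pgf (d : measure_display) (T : measurableType d)
  (R : realType) (P : probability T R) (X : {RV P >-> nat}) (z s : R) :
  0 <= z -> pgf P X z = s%:E ->
  pseries (fun i => fine (P (X @^-1` [set i]))) z @ \oo --> s.
Proof.
move=> z0; rewrite /pgf unlock.
have mX i : measurable (X @^-1` [set i]) by exact: measurable_funPTI.
have mz : measurable_fun [set: T] (fun t => (z ^+ X t)%:E).
  apply/measurable_EFinP.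
  apply: (@measurableT_comp _ _ _ _ _ _ ((fun n => z ^+ n) : nat -> R)) => //.
have cov : [set: T] = \bigcup_i (X @^-1` [set i]).
  by apply/seteqP; split => // t _; exists (X t).
rewrite [in LHS]cov ge0_integral_bigcup//; last 3 first.
- by rewrite -cov.
- by move=> t _; rewrite lee_fin exprn_ge0.
- by apply/trivIsetP => i j _ _ /eqP ij; apply/seteqP; split => // t /= [] -> /ij.
under eq_eseriesr.
  move=> i _.
  have -> : (\int[P]_(x in X @^-1` [set i]) (z ^+ X x)%:E
     = (fine (P (X @^-1` [set i])) * z ^+ i)%:E)%E.
    rewrite (eq_integral (cst (z ^+ i)%:E)); last by move=> t /set_mem /= ->.
    by rewrite integral_cst// EFinM fineK ?fin_num_measure// muleC.
  over.
move=> h.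
have : (fun n => \sum_(0 <= i < n) (fine (P (X @^-1` [set i])) * z ^+ i)%:E)%E
   @ \oo --> s%:E.
  rewrite -h; apply: is_cvg_nneseries => n _ _.
  by rewrite lee_fin mulr_ge0 ?exprn_ge0// fine_ge0.
under eq_fun do rewrite sumEFin.
by move/fine_cvgP => [_].
Qed.

Lemma probability_of_pgf (d : measure_display) (T : measurableType d)
  (R : realType) (P : probability T R) (X : {RV P >-> nat}) (f : R^nat) :
  (forall n, 0 <= f n) -> cvgn (series f) ->
  (forall z, 0 <= z <= 1 -> pgf P X z = (fps_eval f z)%:E) ->
  forall i, P (X @^-1` [set i]) = (f i)%:E.
Proof.
move=> f0 cf fX i.
have -> : f i = fine (P (X @^-1` [set i])).
  have ps1 (a : R^nat) : pseries a 1 = series a.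
    by rewrite /pseries; congr series; apply/funext => n /=; rewrite expr1n mulr1.
  apply: (@pseries_coef_unique R f (fun i => fine (P (X @^-1` [set i])))
    (fps_eval f)) => //.
  - by move=> n; rewrite fine_ge0.
  - rewrite -ps1; apply: cvgP; apply: cvg_pseries_pgf => //.
    by apply: fX; rewrite lexx ler01.
  - move=> z /andP[z0 z1].
    suff : cvgn (pseries f z) by [].
    apply: series_le_cvg cf => n.
    + by rewrite mulr_ge0// exprn_ge0.
    + exact: f0.
    + by rewrite ler_piMr// exprn_ile1.
  - by move=> z z01; apply: cvg_pseries_pgf; [case/andP: z01|exact: fX].
by rewrite fineK// fin_num_measure//; exact: measurable_funPTI.
Qed.

(** * Comparing two probabilities through finitely many events *)
Lemma measurable_preimage_countable (d : measure_display) (T : measurableType d)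
  (C : countType) (g : T -> C) (B : set C) :
  (forall c, measurable (g @^-1` [set c])) -> measurable (g @^-1` B).
Proof.
move=> mg.
have -> : g @^-1` B = \bigcup_c (if `[< B c >] then g @^-1` [set c] else set0).
  apply/seteqP; split => [t Bt|t [c _]].
    by exists (g t) => //=; case: asboolP.
  by case: asboolP => //= Bc; rewrite /preimage/= => ->.
apply: countable_bigcupT_measurable => // c.
by case: ifP => _; [exact: mg|exact: measurable0].
Qed.

Lemma sum_probability_le (d : measure_display) (T : measurableType d)
  (R : realType) (P : probability T R) (C : finType) (D : pred C)
  (E : C -> set T) (e : C -> R) (S : set T) :
  (forall c, D c -> measurable (E c)) ->
  trivIset [set c | D c] E ->
  (forall c, D c -> P (E c) = (e c)%:E) -> measurable S ->
  (forall c, D c -> E c `<=` S) ->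
  \sum_(c | D c) e c <= fine (P S).
Proof.
move=> mE tE PE mS ES; rewrite -lee_fin fineK ?fin_num_measure//.
have memD c : [set` enum D] c = D c :> Prop by rewrite /= mem_enum.
have fD : finite_set [set` enum D] by exact: finite_seq.
have tE' : trivIset [set` enum D] E.
  by move=> i j; rewrite !memD; exact: tE.
have mE' c : [set` enum D] c -> measurable (E c) by rewrite memD; exact: mE.
have -> : ((\sum_(c | D c) e c)%:E = P (\bigcup_(c in [set` enum D]) E c))%E.
  rewrite measure_fin_bigcup// -fsbig_seq ?enum_uniq// big_enum/= -sumEFin.
  by apply: eq_bigr => c Dc; rewrite PE.
apply: le_measure; rewrite ?inE//.
  exact: fin_bigcup_measurable.
by move=> t [c]; rewrite memD => Dc Et; exact: ES Et.
Qed.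

(** A bound on the difference of the probabilities of two events that does not
    mention them, hence is uniform in them. Each of finitely many disjoint
    events [EQ c], [EP c] lies on the same side of [SQ] and of [SP]; those
    inside bound the probabilities of [SQ] and [SP] from below, those outside
    from above. The gap between the lower bound for one probability and the
    upper bound for the other is the mass [1 - \sum_(c | D c) p c] that [P] puts
    outside the events, up to the differences of [q] and [p]. *)
Lemma probability_dist_le (d d' : measure_display) (T : measurableType d)
  (T' : measurableType d') (R : realType) (Q : probability T R)
  (P : probability T' R) (C : finType) (D : pred C)
  (EQ : C -> set T) (EP : C -> set T') (q p : C -> R)
  (SQ : set T) (SP : set T') :
  (forall c, D c -> measurable (EQ c)) -> (forall c, D c -> measurable (EP c)) ->
  trivIset [set c | D c] EQ -> trivIset [set c | D c] EP ->
  (forall c, D c -> Q (EQ c) = (q c)%:E) -> (forall c, D c -> P (EP c) = (p c)%:E) ->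
  measurable SQ -> measurable SP ->
  (forall c, D c -> (EQ c `<=` SQ /\ EP c `<=` SP) \/
                    (EQ c `<=` ~` SQ /\ EP c `<=` ~` SP)) ->
  (`|Q SQ - P SP| <=
    ((1 - \sum_(c | D c) p c) + \sum_(c | D c) `|q c - p c|)%:E)%E.
Proof.
move=> mEQ mEP tEQ tEP QE PE mSQ mSP alt.
pose b c := `[< EQ c `<=` SQ /\ EP c `<=` SP >].
have bF c : D c && ~~ b c -> EQ c `<=` ~` SQ /\ EP c `<=` ~` SP.
  by move=> /andP[Dc /asboolPn]; case: (alt c Dc).
have bT c : D c && b c -> EQ c `<=` SQ /\ EP c `<=` SP by move=> /andP[_ /asboolP].
have subD (D' : pred C) (U : Type) (E : C -> set U) :
    trivIset [set c | D c] E -> trivIset [set c | D c && D' c] E.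
  by move=> tE i j /= /andP[Di _] /andP[Dj _]; exact: tE.
have Q1 : \sum_(c | D c && b c) q c <= fine (Q SQ).
  apply: (sum_probability_le (E := EQ)) => //.
  - by move=> c /andP[/mEQ].
  - exact: (subD b).
  - by move=> c /andP[/QE].
  - by move=> c /bT[].
have P1 : \sum_(c | D c && b c) p c <= fine (P SP).
  apply: (sum_probability_le (E := EP)) => //.
  - by move=> c /andP[/mEP].
  - exact: (subD b).
  - by move=> c /andP[/PE].
  - by move=> c /bT[].
have Q2 : \sum_(c | D c && ~~ b c) q c <= fine (Q (~` SQ)).
  apply: (sum_probability_le (E := EQ)) => //.
  - by move=> c /andP[/mEQ].
  - exact: (subD (predC b)).
  - by move=> c /andP[/QE].
  - exact: measurableC.
  - by move=> c /bF[].
have P2 : \sum_(c | D c && ~~ b c) p c <= fine (P (~` SP)).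
  apply: (sum_probability_le (E := EP)) => //.
  - by move=> c /andP[/mEP].
  - exact: (subD (predC b)).
  - by move=> c /andP[/PE].
  - exact: measurableC.
  - by move=> c /bF[].
have [x Qx] : exists x : R, Q SQ = x%:E.
  by exists (fine (Q SQ)); rewrite fineK ?fin_num_measure.
have [y Py] : exists y : R, P SP = y%:E.
  by exists (fine (P SP)); rewrite fineK ?fin_num_measure.
move: Q1 Q2 P1 P2; rewrite !probability_setC// Qx Py -!EFinB abse_EFin lee_fin /=.
rewrite ![\sum_(c | D c) _](bigID b)/=.
set q1 := \sum_(c | _ && b c) q c; set q2 := \sum_(c | _ && ~~ b c) q c.
set p1 := \sum_(c | _ && b c) p c; set p2 := \sum_(c | _ && ~~ b c) p c.
set s1 := \sum_(c | _ && b c) `|_|; set s2 := \sum_(c | _ && ~~ b c) `|_|.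
have h1 : `|q1 - p1| <= s1 by rewrite -sumrB ler_norm_sum.
have h2 : `|q2 - p2| <= s2 by rewrite -sumrB ler_norm_sum.
move: h1 h2; rewrite !ler_norml; lra.
Qed.

(** * Vectors with one large coordinate *)

(** The subtraction is truncated: the coordinates add up to [n] only if those of
    [u] other than [k] add up to at most [n]. *)
Definition big_jump (l n : nat) (k : 'I_l) (u : 'I_l -> nat) : 'I_l -> nat :=
  fun j => if j == k then (n - \sum_(i < l | i != k) u i)%N else u j.

Lemma sum_big_jump (l n : nat) (k : 'I_l) (u : 'I_l -> nat) :
  (\sum_(i < l | i != k) u i <= n)%N ->
  (\sum_(j < l) big_jump n k u j)%N = n.
Proof.
move=> un; rewrite (bigD1 k)//= /big_jump eqxx.
under eq_bigr => j /negPf -> do [].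
by rewrite subnK.
Qed.

Lemma sum_others_le (l K : nat) (k : 'I_l) (u : 'I_l -> nat) :
  (forall j, u j <= K)%N -> (\sum_(j < l | j != k) u j <= l * K)%N.
Proof.
move=> uK; apply: (@leq_trans (\sum_(j < l) K)%N).
  by rewrite big_mkcond; apply: leq_sum => j _; case: ifP.
by rewrite sum_nat_const card_ord.
Qed.
(** For large [n] the position of the large coordinate can be read off the
    vector: coordinate [k] is at least [n - l * K > K], and all the others are
    at most [K]. *)
Lemma big_jump_inj (l n K : nat) (k k' : 'I_l) (u u' : 'I_l -> nat) :
  (forall j, u j <= K)%N -> (forall j, u' j <= K)%N -> (l.+1 * K < n)%N ->
  big_jump n k u = big_jump n k' u' ->
  k = k' /\ forall j, j != k -> u j = u' j.
Proof.
move=> uK u'K Kn uu'.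
have kk' : k = k'.
  apply/eqP; apply/negPn/negP => /negPf kk'.
  have := congr1 (fun f => f k) uu'; rewrite /big_jump eqxx kk' => h.
  have := sum_others_le k uK; have := u'K k; rewrite -h; nia.
split=> // j /negPf jk; have := congr1 (fun f => f j) uu'.
by rewrite /big_jump -kk' jk.
Qed.

Lemma Lambda_big_jump (T : Type) (l : nat) (I : T -> 'I_l) (X : 'I_l -> T -> nat)
  (n : nat) (t : T) (k : 'I_l) (u : 'I_l -> nat) :
  (\sum_(i < l | i != k) u i <= n)%N ->
  I t = k -> (forall j, j != k -> X j t = u j) ->
  Lambda I X n t = to_intvec (big_jump n k u).
Proof.
move=> un It Xt; apply/funext => j; rewrite /Lambda /to_intvec /big_jump It.
case: ifPn => [_|/Xt -> //].
rewrite -subzn// (big_morph Posz PoszD (erefl _)); congr (_ - _).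
by rewrite (eq_bigr (fun i => (u i)%:Z)) => [|i /Xt ->//].
Qed.

Lemma to_intvec_inj (l : nat) : injective (@to_intvec l).
Proof.
by move=> m m' mm'; apply/funext => j; have [] := congr1 (fun f => f j) mm'.
Qed.

(** The independence condition is used for the indices other than [Some k]: the
    event leaves [X k] free, since [Lambda] overwrites its value. *)
Lemma independent_family_event (d : measure_display) (T : measurableType d)
  (R : realType) (P : probability T R) (l : nat) (I : T -> 'I_l)
  (X : 'I_l -> T -> nat) (p : 'I_l -> R) (f : 'I_l -> R^nat)
  (k : 'I_l) (u : 'I_l -> nat) :
  independent_family P I X ->
  (forall k, P (I @^-1` [set k]) = (p k)%:E) ->
  (forall j i, P (X j @^-1` [set i]) = (f j i)%:E) ->
  P [set t | I t = k /\ forall j, j != k -> X j t = u j]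
  = (p k * \prod_(j < l | j != k) f j (u j))%:E.
Proof.
move=> ind PI PX.
pose E (j : option 'I_l) : set T :=
  if j is Some j then X j @^-1` [set u j] else I @^-1` [set k].
have := ind [set~ Some k]%SET E; have -> :
  \bigcap_(j in [set j | j \in [set~ Some k]%SET]) E j
  = [set t | I t = k /\ forall j, j != k -> X j t = u j].
  apply/seteqP; split => [t h|t [It Xt] [j|] /=].
  - split; first by apply: (h None); rewrite /= !inE.
    by move=> j jk; apply: (h (Some j)); rewrite /= !inE.
  - by rewrite !inE => /Xt.
  - by [].
move=> ->; last first.
  by move=> [j|] _; [exists [set u j]|exists [set k]]; rewrite ?setTI.
rewrite (bigD1 None) ?inE//= PI EFinM; congr (_ * _)%E.
rewrite (reindex_omap Some id)/=; last by move=> [j|] /andP[].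
rewrite -prodEFin; apply: eq_big => [j|j _]; last by rewrite PX.
by rewrite !inE eqxx !andbT.
Qed.

(** The condition [u k == ord0] fixes the coordinate of [u] that is absent
    from the products, so that the sum is an expanded product of partial sums. *)
Lemma sum_big_jump_family (R : realType) (l K : nat) (k : 'I_l) (f : 'I_l -> R^nat) :
  \sum_(u : {ffun 'I_l -> 'I_K.+1} | u k == ord0) \prod_(j < l | j != k) f j (u j)
  = \prod_(j < l | j != k) series (f j) K.+1.
Proof.
pose F (j : 'I_l) (i : 'I_K.+1) := if j == k then 1 else f j i.
pose S (j : 'I_l) (i : 'I_K.+1) := (j != k) || (i == ord0).
have := bigA_distr_big_dep (zero := 0) (one := 1) (times := *%R) (plus := +%R) S F.
rewrite (bigD1 k)//= [X in X * _](_ : _ = 1); last first.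
  rewrite (eq_bigl (pred1 ord0)); last by move=> i; rewrite /S eqxx.
  by rewrite big_pred1_eq /F eqxx.
rewrite mul1r => h; rewrite (eq_bigr (fun j => \sum_(i | S j i) F j i)).
  rewrite h; apply: eq_big => [u|u _].
    apply/idP/familyP => [/eqP uk j|/(_ k)]; rewrite /S unfold_in.
      by case: eqVneq => //= ->; rewrite uk.
    by rewrite eqxx.
  rewrite [RHS](bigD1 k)//= {1}/F eqxx mul1r.
  by apply: eq_bigr => j /negPf jk; rewrite /F jk.
move=> j jk; rewrite /series/= big_mkord; apply: eq_big => [i|i _].
  by rewrite /S jk.
by rewrite /F (negPf jk).
Qed.

(** The total variation limit. The index set of the comparison consists of the
    pairs [(k, u)] of a position and of a vector [u] of other coordinates bounded
    by [K]. On the event that [I = k] and [X j = u j] for [j != k], the vector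
    [Lambda] equals [big_jump n k u], and the probability of this event does not
    depend on [n]; the events that [Y n] equals [big_jump n k u] have the same
    probabilities in the limit, by hypothesis. For fixed [K] the bound of
    [probability_dist_le] tends to the probability that [P] puts outside these
    events, which vanishes as [K] grows because each [f j] has mass 1. *)
Lemma cvg_sup_distance_big_jump (d : measure_display) (T : measurableType d)
  (R : realType) (P : probability T R) (l : nat) (I : T -> 'I_l)
  (X : 'I_l -> {RV P >-> nat}) (p : 'I_l -> R) (f : 'I_l -> R^nat)
  (dQ : nat -> measure_display) (TQ : forall n, measurableType (dQ n))
  (Q : forall n, probability (TQ n) R)
  (Y : forall n, 'I_l -> {RV (Q n) >-> nat}) :
  (forall k, measurable (I @^-1` [set k])) ->
  independent_family P I (fun k => X k : T -> nat) ->
  (forall k, P (I @^-1` [set k]) = (p k)%:E) ->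
  (forall j i, P (X j @^-1` [set i]) = (f j i)%:E) ->
  \sum_(k < l) p k = 1 ->
  (forall j, series (f j) @ \oo --> (1 : R)) ->
  (forall k (u : 'I_l -> nat),
     fine (Q n [set t | forall j, Y n j t = big_jump n k u j]) @[n --> \oo] -->
     p k * \prod_(j < l | j != k) f j (u j)) ->
  sup_distance (Q n) P (fun t k => Y n k t)
    (Lambda I (fun k => X k : T -> nat) n) @[n --> \oo] --> 0%E.
Proof.
move=> mI ind PI PX p1 f1 Qcvg.
have mX j i : measurable (X j @^-1` [set i]) by exact: measurable_funPTI.
have mY n j i : measurable (Y n j @^-1` [set i]) by exact: measurable_funPTI.
have mEQ n (m : 'I_l -> nat) : measurable [set t | forall j, Y n j t = m j].
  rewrite [X in measurable X](_ : _ = \bigcap_j (Y n j @^-1` [set m j])).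
    by apply: fin_bigcap_measurable => //; exact: finite_finset.
  by apply/seteqP; split => [t h j _|t h j]; exact: h.
have mEP k (u : 'I_l -> nat) :
    measurable [set t | I t = k /\ forall j, j != k -> X j t = u j].
  rewrite [X in measurable X](_ : _ = I @^-1` [set k] `&`
      \bigcap_(j in [set j | j != k]) (X j @^-1` [set u j])).
    apply: measurableI => //.
    by apply: fin_bigcap_measurable => //; exact: finite_finset.
  by apply/seteqP; split => t [It h]; split => // j jk; exact: h.
have mSQ n (A : set ('I_l -> nat)) : measurable ((fun t k => Y n k t) @^-1` A).
  rewrite [X in measurable X](_ : _ = (fun t => [ffun k => Y n k t]) @^-1`
      [set m : {ffun 'I_l -> nat} | A m]).
    apply: measurable_preimage_countable => m.
    rewrite [X in measurable X](_ : _ = [set t | forall j, Y n j t = m j])//.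
    apply/seteqP; split => t /= h; last by apply/ffunP => j; rewrite ffunE.
    by move=> j; rewrite -h ffunE.
  suff E t : ([ffun k => Y n k t] : 'I_l -> nat) = fun k => Y n k t.
    by apply/seteqP; split => t /=; rewrite E.
  by apply/funext => j; rewrite ffunE.
have mSP n (A : set ('I_l -> int)) :
    measurable (Lambda I (fun k => X k : T -> nat) n @^-1` A).
  (* [Lambda] as a function of the countable datum of the values of [I] and
     [X]. *)
  pose L (c : 'I_l * {ffun 'I_l -> nat}) :=
    Lambda (fun _ : unit => c.1) (fun j _ => c.2 j) n tt.
  rewrite [X in measurable X](_ : _ = (fun t => (I t, [ffun k => X k t])) @^-1`
      [set c | A (L c)]).
    apply: measurable_preimage_countable => -[k u].
    rewrite [X in measurable X](_ : _ = I @^-1` [set k] `&`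
      \bigcap_j (X j @^-1` [set u j])).
      apply: measurableI => //.
      by apply: fin_bigcap_measurable => //; exact: finite_finset.
    apply/seteqP; split => t /=.
      by move=> [-> <-]; split=> // j _; rewrite /= ffunE.
    by move=> [-> h]; congr (_, _); apply/ffunP => j; rewrite ffunE; exact: h.
  suff LE t : L (I t, [ffun k => X k t]) = Lambda I (fun k => X k : T -> nat) n t.
    by apply/seteqP; split => t /=; rewrite LE.
  apply/funext => j; rewrite /L /Lambda /= ffunE; case: ifP => // _; congr (_ - _).
  by apply: eq_bigr => i _; rewrite ffunE.
(* The event of [c] does not depend on the coordinate [c.1] of [c.2]; fixing
   this coordinate makes events of distinct indices disjoint. *)
pose D K (c : 'I_l * {ffun 'I_l -> 'I_K.+1}) := c.2 c.1 == ord0.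
pose un K (u : {ffun 'I_l -> 'I_K.+1}) : 'I_l -> nat := fun j => u j.
pose pi K (c : 'I_l * {ffun 'I_l -> 'I_K.+1}) : R :=
  p c.1 * \prod_(j < l | j != c.1) f j (c.2 j).
pose q K n (c : 'I_l * {ffun 'I_l -> 'I_K.+1}) : R :=
  fine (Q n [set t | forall j, Y n j t = big_jump n c.1 (un K c.2) j]).
pose V K n : R := (1 - \sum_(c | D K c) pi K c) + \sum_(c | D K c) `|q K n c - pi K c|.
pose s n := sup_distance (Q n) P (fun t k => Y n k t)
    (Lambda I (fun k => X k : T -> nat) n).
have s0 n : (0 <= s n)%E.
  apply: (@le_trans _ _ `|Q n ((fun t k => Y n k t) @^-1` set0) -
    P (Lambda I (fun k => X k : T -> nat) n @^-1` (@to_intvec l @` set0))|%E) => //.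
  by apply: ereal_sup_ubound; exists set0.
have sV K : \forall n \near \oo, (s n <= (V K n)%:E)%E.
  near=> n; have Kn : (l.+1 * K < n)%N by near: n; exact: nbhs_infty_gt.
  apply: ge_ereal_sup => _ [A _ <-].
  have uK (u : {ffun 'I_l -> 'I_K.+1}) j : (un K u j <= K)%N.
    by rewrite /un -ltnS ltn_ord.
  have un_le k (u : {ffun 'I_l -> 'I_K.+1}) :
      (\sum_(i < l | i != k) un K u i <= n)%N.
    by have := sum_others_le k (uK u); nia.
  apply: (@probability_dist_le _ _ _ _ _ _ _ _ (D K)
    (fun c => [set t | forall j, Y n j t = big_jump n c.1 (un K c.2) j])
    (fun c => [set t | I t = c.1 /\ forall j, j != c.1 -> X j t = un K c.2 j])) => //.
  - move=> [k u] [k' u'] /eqP/= Du /eqP/= Du' [t [/= h h']].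
    have [kk' uu'] : k = k' /\ forall j, j != k -> un K u j = un K u' j.
      apply: big_jump_inj (uK u) (uK u') Kn _.
      by apply/funext => j; rewrite -h -h'.
    rewrite -kk' in Du' *; congr (_, _); apply/ffunP => j.
    case: (eqVneq j k) => [->|/uu' jk]; first by rewrite Du Du'.
    exact: val_inj.
  - move=> [k u] [k' u'] /eqP/= Du /eqP/= Du' [t [/= [It h] [It' h']]].
    have kk' : k = k' by rewrite -It -It'.
    rewrite -kk' in Du' h' *; congr (_, _); apply/ffunP => j.
    case: (eqVneq j k) => [->|jk]; first by rewrite Du Du'.
    by apply: val_inj; rewrite -[val _]/(un K u j) -h// h'.
  - by move=> c _; rewrite /q fineK// fin_num_measure.
  - by move=> [k u] _; exact: independent_family_event.
  - move=> [k u] _ /=.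
    have EA t : I t = k /\ (forall j, j != k -> X j t = un K u j) ->
        Lambda I (fun k => X k : T -> nat) n t = to_intvec (big_jump n k (un K u)).
      by move=> [It Xt]; exact: Lambda_big_jump.
    have EY t : (forall j, Y n j t = big_jump n k (un K u) j) ->
      (fun j => Y n j t) = big_jump n k (un K u) by move=> h; apply/funext.
    have [Am|Am] := pselect (A (big_jump n k (un K u))); [left|right]; split => t /=.
    + by move=> /EY ->.
    + by move=> /EA ->; exists (big_jump n k (un K u)).
    + by move=> /EY ->.
    + by move=> /EA -> [m Amm /to_intvec_inj mE]; apply: Am; rewrite -mE.
suff h : (fine \o s) n @[n --> \oo] --> (0 : R).
  apply/fine_cvgP; split => //.
  have [N _ sVN] := sV 0%N; exists N => // n Nn.
  by rewrite fin_numElt (lt_le_trans _ (s0 n))// (le_lt_trans (sVN n Nn))// ltry.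
apply: (@cvg_double_limit R _ (fun=> 0)
  (fun K => 1 - \sum_(c | D K c) pi K c) 0 (fun _ _ => 0) V).
- by move=> K; exact: cvg_cst.
- move=> K; rewrite -[X in _ --> X]addr0; apply: cvgD; first exact: cvg_cst.
  rewrite -[X in _ --> X](_ : \sum_(c | D K c) `|pi K c - pi K c| = 0); last first.
    by rewrite big1// => c _; rewrite subrr normr0.
  apply: cvg_big => [|c _]; first exact: add_continuous.
  by apply: cvg_norm; apply: cvgB; [exact: Qcvg|exact: cvg_cst].
- exact: cvg_cst.
- have piE K : \sum_(c | D K c) pi K c
      = \sum_(k < l) p k * \prod_(j < l | j != k) series (f j) K.+1.
    rewrite -(pair_big_dep xpredT (fun k (u : {ffun 'I_l -> 'I_K.+1}) => u k == ord0)
      (fun k u => p k * \prod_(j < l | j != k) f j (u j)))/=.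
    by apply: eq_bigr => k _; rewrite -big_distrr/= sum_big_jump_family.
  rewrite (_ : (fun K => _) = fun K => 1 -
    \sum_(k < l) p k * \prod_(j < l | j != k) series (f j) K.+1); last first.
    by apply/funext => K; rewrite piE.
  rewrite -[X in _ --> X](subrr 1); apply: cvgB; first exact: cvg_cst.
  rewrite -[X in _ --> X]p1; apply: cvg_big => [|k _]; first exact: add_continuous.
  rewrite -[X in _ --> X]mulr1; apply: cvgMl_tmp.
  rewrite -[X in _ --> X](_ : \prod_(j < l | j != k) (1 : R) = 1); last by rewrite big1.
  apply: cvg_big => [|j _]; first exact: mul_continuous.
  by rewrite (cvg_shiftS (series (f j))).
- near=> K; have [N _ sVN] := sV K; exists N => // n Nn.
  have := sVN n Nn; rewrite subr0 /= ger0_norm ?fine_ge0//.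
  have sf : s n \is a fin_num.
    by rewrite fin_numElt (lt_le_trans _ (s0 n))// (le_lt_trans (sVN n Nn))// ltry.
  by rewrite -[in X in X -> _](fineK sf) lee_fin.
Unshelve. all: by end_near. Qed.

(** * The limit theorem *)
Theorem lemma3p17 (R : realType) (l : nat) (hl : (2 <= l)%N)
  (w : 'I_l -> R^nat)
  (hw_ge0 : forall k n, 0 <= w k n)
  (hw_neq0 : forall k, exists n, w k n != 0)
  (r : R^nat) (hr : subexponential r)
  (lam : 'I_l -> R)
  (hlam : forall k, w k n / r n @[n --> \oo] --> lam k)
  (hlam_pos : exists k, 0 < lam k) :
  let o := fps_prod w in
  subexponential o /\
  (forall k, cvgn (pseries (w k) (rho o))) /\
  exists p : 'I_l -> R,
    [/\ forall k, (w k n * fps_eval o (rho o)) / (o n * fps_eval (w k) (rho o))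
                    @[n --> \oo] --> p k,
        forall k, 0 <= p k <= 1,
        \sum_(k < l) p k = 1 &
        forall (d : measure_display) (T : measurableType d)
          (P : probability T R) (I : T -> 'I_l)
          (X : 'I_l -> {RV P >-> nat})
          (hI_meas : forall k, measurable (I @^-1` [set k]))
          (hI : forall k, P (I @^-1` [set k]) = (p k)%:E)
          (hX : forall k (z : R), 0 <= z <= 1 ->
             pgf P (X k) z
             = (fps_eval (w k) (z * rho o) / fps_eval (w k) (rho o))%:E)
          (hIX : independent_family P I (fun k => X k : T -> nat))
          (dQ : nat -> measure_display)
          (TQ : forall n, measurableType (dQ n))
          (Q : forall n, probability (TQ n) R)
          (Y : forall n, 'I_l -> {RV (Q n) >-> nat})
          (hY : forall n, 0 < o n -> forall m : 'I_l -> nat,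
             (\sum_(k < l) m k)%N = n ->
             Q n [set t | forall k, Y n k t = m k]
             = ((\prod_(k < l) w k (m k)) / o n)%:E),
        sup_distance (Q n) P (fun t k => Y n k t)
          (Lambda I (fun k => X k : T -> nat) n)
          @[n --> \oo] --> 0%E].
Proof.
move=> o.
have rho0 := subexponential_rho_gt0 hr.
have rpos := subexponential_near_gt0 hr.
have cw k : cvgn (pseries (w k) (rho r)).
  exact: is_cvg_pseries_of_cvg_div (hlam k).
have W0 k : 0 < fps_eval (w k) (rho r) by exact: fps_eval_gt0.
have o0 : forall n, 0 <= o n by exact: fps_prod_seq_ge0.
have oE : fps_eval o (rho r) = \prod_(k < l) fps_eval (w k) (rho r).
  by apply: cvg_lim => //; apply: cvg_pseries_fps_prod => //; exact: ltW.
pose M := \sum_(k < l) lam k / fps_eval (w k) (rho r).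
have lam0 k : 0 <= lam k.
  rewrite -(cvg_lim (@Rhausdorff R) (hlam k)); apply: limr_ge.
    exact: cvgP (hlam k).
  by near=> n; rewrite divr_ge0// ltW//; near: n.
have M0 : 0 < M.
  have [k lk] := hlam_pos; rewrite /M (bigD1 k)//= ltr_wpDr ?divr_gt0//.
  by apply: sumr_ge0 => j _; rewrite divr_ge0// ltW.
have O0 : 0 < fps_eval o (rho r) by rewrite oE; apply: prodr_gt0.
have or : o n / r n @[n --> \oo] --> fps_eval o (rho r) * M.
  by rewrite oE; exact: cvg_fps_prod_div.
have L0 : 0 < fps_eval o (rho r) * M by rewrite mulr_gt0.
have so := subexponential_cvg_div hr o0 L0 or.
have rhoo : rho o = rho r.
  by rewrite /rho (cv_radius_cvg_div o0 _ rpos L0 or)//; case: hr.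
have opos := subexponential_near_gt0 so.
have ro := cvg_div_inv L0 or.
split; first exact: so.
rewrite rhoo; split; first exact: cw.
(* The asymptotic weight of a large coordinate at [k], relative to [o]. *)
pose p k := lam k / fps_eval (w k) (rho r) / M.
have p0 k : 0 <= p k by rewrite !divr_ge0// ltW.
have p1 : \sum_(k < l) p k = 1.
  by rewrite -big_distrl/= -/M divff// gt_eqF.
exists p; split.
- move=> k.
  rewrite [X in _ --> X](_ : _ = (lam k * (fps_eval o (rho r) * M)^-1) *
    (fps_eval o (rho r) / fps_eval (w k) (rho r))); last first.
    by rewrite /p; field; rewrite !gt_eqF.
  apply: cvg_trans (cvgMr_tmp (cvgM (hlam k) ro)); apply: near_eq_cvg.
  near=> n => /=.
  have rn : 0 < r n by near: n.
  have on : 0 < o n by near: n.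
  by field; rewrite !gt_eqF.
- move=> k; rewrite p0/= -p1 (bigD1 k)//= lerDl.
  by apply: sumr_ge0 => j _.
- exact: p1.
move=> d T P I X mI PI PX ind dQ TQ Q Y QY.
(* The law of [X j], as read off its generating function. *)
pose f j i := w j i * rho r ^+ i / fps_eval (w j) (rho r).
have fE j : series (f j) = fun n => pseries (w j) (rho r) n / fps_eval (w j) (rho r).
  by apply/funext => n; rewrite /pseries /series/= big_distrl.
have f1 j : series (f j) @ \oo --> (1 : R).
  rewrite fE -[X in _ --> X](@divff _ (fps_eval (w j) (rho r))) ?gt_eqF//.
  exact: cvgMr_tmp.
apply: (cvg_sup_distance_big_jump (p := p) (f := f)) => //.
- move=> j; apply: probability_of_pgf => [n||z z01].
  + by rewrite divr_ge0 ?mulr_ge0 ?exprn_ge0// ltW.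
  + exact: cvgP (f1 j).
  + rewrite PX//; congr (_%:E); rewrite /fps_eval -/(fps_eval (w j) (rho r)).
    have z0 : 0 <= z by case/andP: z01.
    have cz : cvgn (pseries (w j) (z * rho r)).
      apply: series_le_cvg (cw j) => n.
      * by rewrite mulr_ge0// exprn_ge0// mulr_ge0// ltW.
      * by rewrite mulr_ge0// exprn_ge0// ltW.
      * rewrite ler_wpM2l// exprMn ler_piMl//; first exact/exprn_ge0/ltW.
        by case/andP: z01 => _ z1; exact: exprn_ile1.
    apply/esym; apply: cvg_lim => //.
    rewrite (_ : pseries (f j) z = fun n =>
        pseries (w j) (z * rho r) n / fps_eval (w j) (rho r)).
      exact: cvgMr_tmp.
    apply/funext => n; rewrite /pseries /series/= big_distrl/=.
    by apply: eq_bigr => i _; rewrite /f exprMn; field; rewrite gt_eqF.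
- move=> k u.
  pose S := (\sum_(i < l | i != k) u i)%N.
  pose Pw := \prod_(j < l | j != k) w j (u j).
  (* The probability of [big_jump n k u] is [w k (n - S) * Pw / o n], with a
     large index in a single factor. *)
  rewrite [X in _ --> X](_ : _ =
    (lam k * rho r ^+ S * (fps_eval o (rho r) * M)^-1) * Pw); last first.
    rewrite /f /p big_split/= big_split/= prodrXr -/S -/Pw prodfV oE.
    rewrite [\prod_(i < l) _](bigD1 k)//=; field.
    by rewrite !gt_eqF// prodr_gt0.
  have wr : w k (n - S)%N / r n @[n --> \oo] --> lam k * rho r ^+ S.
    exact: cvg_subn_div.
  apply: cvg_trans (cvgMr_tmp (cvgM wr ro)).
  apply: near_eq_cvg; near=> n => /=.
  have rn : 0 < r n by near: n.
  have on : 0 < o n by near: n.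
  have Sn : (S <= n)%N by near: n; exact: nbhs_infty_ge.
  rewrite QY ?sum_big_jump//= (bigD1 k)//= {1}/big_jump eqxx -/S.
  rewrite (eq_bigr (fun j => w j (u j))); last first.
    by move=> j /negPf jk; rewrite /big_jump jk.
  by rewrite -/Pw; field; rewrite !gt_eqF.
Unshelve. all: by end_near. Qed.
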